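(* Let $\omega=2\pi/3$ (so that two consecutive phalanxes form either the angle $\pi$ or the angle $\pi-\omega=\pi/3$). If the ratio satisfies $\rho\ge 2$, then no configuration of the finger is self-intersecting; that is, for every integer $K\ge 1$, every $\omega_0\in[0,2\pi)$ and all control vectors $(u_j)_{j=1}^K,(v_j)_{j=1}^K\in\{0,1\}^K$, the corresponding configuration $(x_k)_{k=0}^K$ is not self-intersecting.
   Context: A finger is a planar manipulator, and its plane is identified with $\mathbb{C}$. It has a scaling ratio $\rho>1$, a rotation angle $\omega\in(0,\pi)$ and an initial orientation $\omega_0\in[0,2\pi)$. Given an integer $K\ge1$ and binary control vectors $(u_j)_{j=1}^K,(v_j)_{j=1}^K\in\{0,1\}^K$ (extension controls and rotation controls respectively), the corresponding configuration is the finite sequence of junctions $(x_k)_{k=0}^K\subset\mathbb{C}$ given by $x_0=0$ and $$x_k=\sum_{j=1}^k\frac{u_j}{\rho^j}\,e^{-i\left(\omega_0+\sum_{n=1}^j v_n\omega\right)},\qquad 1\le k\le K.$$ The $k$-th phalanx is the closed segment with endpoints $x_{k-1}$ and $x_k$; it has length $u_k/\rho^k$, and it is called extended if $u_k=1$ (if $u_k=0$ it reduces to a point). Configurations are always finite sequences. A configuration is self-intersecting if there are indices $1\le j<k\le K$ with $u_j=u_k=1$ such that the $j$-th and the $k$-th phalanxes have a common point, other than the common junction $x_j=x_{k-1}$ in the case where they are consecutive extended phalanxes (i.e. $u_n=0$ for all $j<n<k$). *)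

(* Defs.v *)
From mathcomp Require Import all_boot all_order all_algebra.
From mathcomp Require Import boolp classical_sets reals trigo.
From mathcomp Require Import complex.

Set Implicit Arguments.
Unset Strict Implicit.
Unset Printing Implicit Defensive.

Import Order.TTheory GRing.Theory Num.Theory.

Local Open Scope ring_scope.
Local Open Scope classical_set_scope.
Local Open Scope complex_scope.

(* exp (i * t) for a real t *)
Definition expi (R : realType) (t : R) : R[i] := cos t +i* sin t.

Definition closed_segment (R : realType) (a b : R[i]) : set R[i] :=
  [set z | exists2 t : R, 0 <= t <= 1 & z = (1 - t)%:C * a + t%:C * b].

(* Control vectors are indexed from 0: the ordinal j : 'I_K stands for the     *)
(* 1-based index j.+1, so u j is u_{j+1}, whence the exponent j.+1 below.      *)
(* Junctions keep their usual numbering x_0, ..., x_K.                         *)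

Definition orientation (R : realType) (omega omega0 : R) (K : nat)
    (v : 'I_K -> bool) (j : 'I_K) : R :=
  omega0 + \sum_(n < K | (n <= j)%N) (v n)%:R * omega.

Definition junction (R : realType) (rho omega omega0 : R) (K : nat)
    (u v : 'I_K -> bool) (k : nat) : R[i] :=
  \sum_(j < K | (j < k)%N)
    ((u j)%:R / rho ^+ j.+1)%:C * expi (- orientation omega omega0 v j).

Definition phalanx (R : realType) (rho omega omega0 : R) (K : nat)
    (u v : 'I_K -> bool) (k : 'I_K) : set R[i] :=
  closed_segment (junction rho omega omega0 u v k)
                 (junction rho omega omega0 u v k.+1).

Definition no_extension_between (K : nat) (u : 'I_K -> bool) (j k : 'I_K) :=
  forall n : 'I_K, (j < n < k)%N -> u n = false.

(* The final end junction rho omega omega0 u v j.+1 of the phalanx j is also   *)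
(* the initial end of the phalanx k when nothing is extended in between.       *)
Definition self_intersecting (R : realType) (rho omega omega0 : R) (K : nat)
    (u v : 'I_K -> bool) : Prop :=
  exists j k : 'I_K, [/\ (j < k)%N, u j, u k &
    exists z : R[i],
      [/\ phalanx rho omega omega0 u v j z,
          phalanx rho omega omega0 u v k z &
          ~ (no_extension_between u j k
             /\ z = junction rho omega omega0 u v j.+1)]].

(* Main.v *)
Require Import Defs.
From mathcomp Require Import all_boot all_order all_algebra.
From mathcomp Require Import boolp classical_sets reals trigo.
From mathcomp Require Import complex ring lra zify.

Import Order.TTheory GRing.Theory Num.Theory.

Local Open Scope ring_scope.
Local Open Scope complex_scope.

(** Up to the global rotation by [omega0], every phalanx points in one of the
    three directions [1], [w], [w ^+ 2], where [w] is a primitive cubic root of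
    unity.  Since [1 + w + w ^+ 2 = 0] is the only real relation between them, a
    real combination of the three directions vanishes exactly when its three
    coefficients coincide ([eq_class_totals]).

    Suppose that the phalanxes [j < k] share a point [z].  Going from [z]
    forward along the finger, through the rest of phalanx [j], the phalanxes in
    between and a part of phalanx [k], leads back to [z].  This is a vanishing
    sum of nonnegative multiples of the three directions, so all directions get
    the same total length.  Because [2 <= rho], each extended phalanx is longer
    than all the later ones together ([geometric_tail_lt]).  Consider the first
    nonzero contribution after that of phalanx [j].  Its own direction has a
    total at least as large as it, whereas some direction is used neither by it
    nor by phalanx [j] (two phalanxes cannot exhaust three directions), and
    that direction gets only contributions of later phalanxes, which is strictly
    less.  Hence there is no such contribution, then none from [j] either
    ([superdecreasing_comb_eq0]).  So the closed path is trivial: [z] is the end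
    of phalanx [j] and nothing is extended between [j] and [k]. *)

(** * The cubic root of unity *)

Lemma expiD (R : realType) (s t : R) : expi (s + t) = expi s * expi t.
Proof. by rewrite /expi cosD sinD; simpc; congr (_ +i* _); ring. Qed.

Lemma expi0 (R : realType) : expi (0 : R) = 1.
Proof. by rewrite /expi cos0 sin0. Qed.

Lemma expiMn (R : realType) (t : R) (n : nat) : expi (n%:R * t) = expi t ^+ n.
Proof.
elim: n => [|n IHn]; first by rewrite mul0r expi0 expr0.
by rewrite -natr1 mulrDl mul1r expiD IHn exprSr.
Qed.

Lemma expi_neq0 (R : realType) (t : R) : expi t != 0.
Proof.
apply/eqP => e0; have := expiD R t (- t).
by rewrite subrr e0 mul0r expi0 => /eqP; rewrite oner_eq0.
Qed.

Definition cubic_root (R : realType) : R[i] := expi (- (2 * pi / 3)).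

Lemma cubic_rootX3 (R : realType) : cubic_root R ^+ 3 = 1.
Proof.
rewrite -expiMn (_ : 3%:R * _ = - (pi *+ 2)); last by rewrite mulr2n; field.
by rewrite /expi cosN sinN cos2pi sin2pi oppr0.
Qed.

Lemma Im_cubic_root_neq0 (R : realType) : complex.Im (cubic_root R) != 0.
Proof.
rewrite /= sinN oppr_eq0 gt_eqF //; apply: sin_gt0_pi.
by have := pi_gt0 R; lra.
Qed.

Lemma cubic_root_sum (R : realType) :
  1 + cubic_root R + cubic_root R ^+ 2 = 0.
Proof.
have w_neq1 : cubic_root R - 1 != 0.
  rewrite subr_eq0; apply/eqP => w1; have := Im_cubic_root_neq0 R.
  by rewrite w1 /= eqxx.
apply: (mulfI w_neq1); rewrite mulr0.
rewrite (_ : _ * _ = cubic_root R ^+ 3 - 1); last by ring.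
by rewrite cubic_rootX3 subrr.
Qed.

(** Subtracting [c] times the relation [1 + w + w ^+ 2 = 0] leaves a real
    combination of [1] and [w], which are independent over the reals because
    [w] is not real. *)
Lemma cubic_root_comb_eq0 (R : realType) (a b c : R) :
  a%:C + b%:C * cubic_root R + c%:C * cubic_root R ^+ 2 = 0 -> a = b /\ b = c.
Proof.
move=> abc0.
have lin : (a - c)%:C + (b - c)%:C * cubic_root R = 0.
  rewrite -abc0 !rmorphB /= -[RHS]subr0 -[X in _ = _ - X](mulr0 c%:C).
  by rewrite -(cubic_root_sum R); ring.
have bc : b = c.
  have /(congr1 (@complex.Im R)) := lin.
  move: (Im_cubic_root_neq0 R); case: (cubic_root R) => x y /= y0.
  rewrite mul0r addr0 add0r => /eqP; rewrite mulf_eq0 (negPf y0) orbF subr_eq0.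
  by move/eqP.
split=> //; move: lin; rewrite bc subrr mul0r addr0.
by move/(congr1 (@complex.Re R))/eqP; rewrite /= subr_eq0 => /eqP.
Qed.

(** A direction depends on the number of turns only modulo 3; collecting the
    terms of each residue class gives the three coefficients of
    [cubic_root_comb_eq0]. *)
Lemma eq_class_totals (R : realType) (K : nat) (l : 'I_K -> R)
    (turns : 'I_K -> nat) :
  \sum_i (l i)%:C * cubic_root R ^+ turns i = 0 ->
  forall c d : nat, (c < 3)%N -> (d < 3)%N ->
  \sum_(i | (turns i %% 3 == c)%N) l i = \sum_(i | (turns i %% 3 == d)%N) l i.
Proof.
move=> sum0; pose w := cubic_root R.
pose S (c : nat) := \sum_(i | (turns i %% 3 == c)%N) l i.
have : (S 0)%:C + (S 1)%:C * w + (S 2)%:C * w ^+ 2 = 0.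
  rewrite -sum0 /S !rmorph_sum /= !mulr_suml.
  rewrite [X in X + _ + _]big_mkcond [X in _ + X + _]big_mkcond.
  rewrite [X in _ + _ + X]big_mkcond -!big_split /=.
  apply: eq_bigr => i _; rewrite [in RHS](divn_eq (turns i) 3).
  rewrite exprD mulnC exprM cubic_rootX3 expr1n mul1r.
  by have := ltn_pmod (turns i) (isT : 0 < 3)%N;
    case: (turns i %% 3)%N => [|[|[|]]] //= _; rewrite /w ?expr0 ?expr1; ring.
case/cubic_root_comb_eq0 => S01 S12 c d.
by case: c => [|[|[|]]] // _; case: d => [|[|[|]]] // _;
  rewrite -/(S 0%N) -/(S 1%N) -/(S 2%N) ?S01 ?S12.
Qed.

(** * Superdecreasing combinations of three directions *)

Lemma ler_sum_filter (R : realType) (I : finType) (P Q : pred I) (F : I -> R) :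
  (forall i, 0 <= F i) -> (forall i, P i -> ~~ Q i -> F i = 0) ->
  \sum_(i | P i) F i <= \sum_(i | Q i) F i.
Proof.
move=> F0 PQ; rewrite [leLHS]big_mkcond [leRHS]big_mkcond.
apply: ler_sum => i _; case: (boolP (P i)) => Pi; case: (boolP (Q i)) => Qi //.
by rewrite PQ.
Qed.

(** The coefficient at the initial index [j] is exempt from the domination
    hypothesis, because it is the length of the part of a phalanx that follows
    an arbitrary point and so can be small.  Three directions leave enough room
    for this exception: one of them avoids both [j] and the first nonzero index
    after [j], and its total is too small to equal the other totals. *)
Lemma superdecreasing_comb_eq0 (R : realType) (K : nat) (l : 'I_K -> R)
    (turns : 'I_K -> nat) (j : 'I_K) :
  (forall i, 0 <= l i) ->
  (forall i : 'I_K, (i < j)%N -> l i = 0) ->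
  (forall i : 'I_K, (j < i)%N -> l i != 0 ->
     \sum_(n < K | (i < n)%N) l n < l i) ->
  \sum_i (l i)%:C * cubic_root R ^+ turns i = 0 ->
  forall i, l i = 0.
Proof.
move=> l_ge0 l_before l_super /eq_class_totals totals.
have le_total i : l i <= \sum_(n | (turns n %% 3 == turns i %% 3)%N) l n.
  rewrite -[leLHS](@big_pred1_eq _ 0 +%R _ i).
  by apply: ler_sum_filter => // n /eqP->; rewrite eqxx.
have l_after (i : 'I_K) : (j < i)%N -> l i = 0.
  (* Strong induction: [i] is a first index after [j] with [l i != 0]. *)
  have [m] := ubnP i; elim: m i => // m IHm i le_im lt_ji.
  apply/eqP/negPn/negP => li_neq0.
  have [c [c3 cj ci]] : exists c, [/\ (c < 3)%N, c != turns j %% 3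
      & c != turns i %% 3]%N.
    by have := ltn_pmod (turns i) (isT : 0 < 3)%N;
       have := ltn_pmod (turns j) (isT : 0 < 3)%N;
       case: (turns i %% 3)%N => [|[|[|]]] //;
       case: (turns j %% 3)%N => [|[|[|]]] // _ _;
       ((by exists 0%N) || (by exists 1%N) || (by exists 2%N)).
  have := l_super i lt_ji li_neq0; apply/negP; rewrite -leNgt.
  apply: (le_trans (le_total i)).
  rewrite (totals _ c) ?ltn_pmod //; apply: ler_sum_filter => // n /eqP nc.
  rewrite -leqNgt leq_eqVlt => /orP[/eqP/val_inj ni | lt_ni].
    by rewrite -nc ni eqxx in ci.
  case: (ltngtP n j) => [/l_before // | lt_jn | /val_inj nj].
    by apply: IHm => //; apply: leq_trans lt_ni _.
  by rewrite -nc nj eqxx in cj.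
move=> i; case: (ltngtP i j) => [/l_before // | /l_after // | /val_inj ->].
apply/eqP; rewrite eq_le l_ge0 andbT; apply: (le_trans (le_total j)).
(* Only [l j] is left, so the class of any other residue has total 0. *)
pose c := ((turns j).+1 %% 3)%N.
rewrite (totals _ c) ?ltn_pmod // big1 // => n /eqP nc.
case: (ltngtP n j) => [/l_before // | /l_after // | /val_inj nj].
by move: nc; rewrite nj /c; lia.
Qed.

(** Strictness comes from finiteness: for [q = 2^-1] the infinite tail would be
    equal to [q ^+ i.+1].  The induction keeps the gap [q ^+ m] explicit. *)
Lemma geometric_tail_lt (R : realType) (q : R) (K : nat) (i : 'I_K) :
  0 < q -> q <= 2^-1 -> \sum_(n < K | (i < n)%N) q ^+ n.+1 < q ^+ i.+1.
Proof.
move=> q_gt0 q_le.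
suff tail m : (i < m)%N ->
    \sum_(n < m | (i < n)%N) q ^+ n.+1 <= q ^+ i.+1 - q ^+ m.
  apply: le_lt_trans (tail K (ltn_ord i)) _.
  by rewrite ltrBlDr ltrDl exprn_gt0.
elim: m => // m IHm; rewrite ltnS leq_eqVlt => /orP[/eqP <- | lt_im].
  by rewrite subrr big1 // => n; rewrite ltnNge -ltnS ltn_ord.
rewrite big_mkcond big_ord_recr -big_mkcond /= lt_im.
apply: (le_trans (lerD (IHm lt_im) (lexx _))).
have : 0 <= q ^+ m := exprn_ge0 m (ltW q_gt0).
by rewrite (exprS q m); nra.
Qed.

(** * Points of a phalanx as weighted sums of displacements *)

Definition displacement {R : realType} (rho omega omega0 : R) {K : nat}
    (u v : 'I_K -> bool) (i : 'I_K) : R[i] :=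
  ((u i)%:R / rho ^+ i.+1)%:C * expi (- orientation omega omega0 v i).

(** The fraction of phalanx [i] that has been traversed on reaching the point of
    parameter [s] on phalanx [k]. *)
Definition progress {R : realType} {K : nat} (s : R) (k i : 'I_K) : R :=
  (i < k)%:R + s * (i == k)%:R.

Lemma progress_subE (R : realType) (K : nat) (s t : R) (j k : 'I_K) :
  (j < k)%N -> forall i : 'I_K,
  progress t k i - progress s j i =
    if (i < j)%N then 0 else if i == j then 1 - s
    else if (i < k)%N then 1 else if i == k then t else 0.
Proof.
move=> lt_jk i; rewrite /progress -!val_eqE /=.
by case: (ltngtP i j) => ij; case: (ltngtP i k) => ik /=;
  (lia || rewrite ?(mulr0, mulr1, addr0, add0r, oppr0, subrr)).
Qed.

Lemma phalanx_progress (R : realType) (rho omega omega0 : R) (K : nat)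
    (u v : 'I_K -> bool) (k : 'I_K) (z : R[i]) :
  phalanx rho omega omega0 u v k z ->
  exists2 s : R, 0 <= s <= 1 &
    z = \sum_i (progress s k i)%:C * displacement rho omega omega0 u v i.
Proof.
case=> s s01 ->; exists s => //.
rewrite /junction !mulr_sumr [X in X + _ = _]big_mkcond.
rewrite [X in _ + X = _]big_mkcond -big_split /=.
apply: eq_bigr => i _; rewrite -/(displacement rho omega omega0 u v i).
rewrite /progress ltnS -val_eqE /=; case: ltngtP => _ /=;
  rewrite ?rmorphD ?rmorphB ?rmorphM ?rmorph1 ?rmorph0 /=; ring.
Qed.

Lemma displacementE (R : realType) (rho omega0 : R) (K : nat)
    (u v : 'I_K -> bool) (i : 'I_K) :
  displacement rho (2 * pi / 3) omega0 u v i =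
  expi (- omega0) * (((u i)%:R / rho ^+ i.+1)%:C *
    cubic_root R ^+ \sum_(n < K | (n <= i)%N) v n).
Proof.
rewrite /displacement /orientation opprD expiD mulrCA; congr (_ * (_ * _)).
by rewrite -mulr_suml -natr_sum -mulrN expiMn.
Qed.

(** * Absence of self-intersections *)

Theorem theorem7 (R : realType) (rho : R) (hrho : 2 <= rho)
    (K : nat) (hK : (1 <= K)%N)
    (omega0 : R) (homega0 : 0 <= omega0 < 2 * pi)
    (u v : 'I_K -> bool) :
  ~ self_intersecting rho (2 * pi / 3) omega0 u v.
Proof.
case=> j [k [lt_jk uj uk [z [zj zk]]]]; apply.
have [s /andP[s0 s1] zs] := phalanx_progress _ _ _ _ _ _ _ _ _ zj.
have [t /andP[t0 t1] zt] := phalanx_progress _ _ _ _ _ _ _ _ _ zk.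
(* [g i] is the fraction of phalanx [i] on the closed path from [z], as a point
   of phalanx [j], to [z], as a point of phalanx [k]. *)
pose g i := progress t k i - progress s j i.
pose l i := g i * ((u i)%:R / rho ^+ i.+1).
have rho_gt0 : 0 < rho by lra.
have q_gt0 : 0 < rho^-1 by rewrite invr_gt0.
have q_le : rho^-1 <= 2^-1 by rewrite lef_pV2 ?posrE.
have gE := progress_subE _ _ s t _ _ lt_jk : forall i, g i = _.
have g01 i : 0 <= g i <= 1.
  by rewrite gE; do 4?[case: ifP => _]; rewrite ?lexx ?ler01 ?subr_ge0 ?gerBl;
    apply/andP.
have l_bounds i : 0 <= l i <= rho^-1 ^+ i.+1.
  rewrite /l -exprVn; have : 0 <= rho^-1 ^+ i.+1 := exprn_ge0 _ (ltW q_gt0).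
  have /andP[g0 g1] := g01 i; case: (u i); rewrite ?mul1r ?mul0r; nra.
have l_eq0 : forall i, l i = 0.
  apply: (superdecreasing_comb_eq0 _ _ _
           (fun i : 'I_K => \sum_(n < K | (n <= i)%N) v n)%N j).
  - by move=> i; case/andP: (l_bounds i).
  - by move=> i ij; rewrite /l gE ij mul0r.
  - move=> i ji li.
    (* From [k] on, nothing follows; before [k], phalanx [i] counts in full. *)
    have [ik | ki] := ltnP i k; last first.
      rewrite big1 ?lt0r ?li; first by case/andP: (l_bounds i).
      move=> n lt_in; have lt_kn := leq_ltn_trans ki lt_in.
      have lt_jn := ltn_trans lt_jk lt_kn.
      rewrite /l gE -!val_eqE /= (gtn_eqF lt_jn) (gtn_eqF lt_kn).
      by rewrite !ltnNge (ltnW lt_jn) (ltnW lt_kn) mul0r.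
    have ui : u i by apply: contraNT li => /negPf ui; rewrite /l ui mul0r mulr0.
    have -> : l i = rho^-1 ^+ i.+1.
      rewrite /l gE ui -val_eqE /= (gtn_eqF ji) ik ltnNge (ltnW ji) /=.
      by rewrite !mul1r exprVn.
    apply: le_lt_trans (geometric_tail_lt _ _ _ _ q_gt0 q_le).
    by apply: ler_sum => n _; case/andP: (l_bounds n).
  have diff0 : \sum_i (g i)%:C * displacement rho (2 * pi / 3) omega0 u v i = 0.
    move/eqP: (etrans (esym zt) zs); rewrite -subr_eq0 -sumrB => /eqP zz0.
    by rewrite -[RHS]zz0; apply: eq_bigr => i _; rewrite -mulrBl -rmorphB.
  apply: (mulfI (expi_neq0 R (- omega0))); rewrite mulr0 -[RHS]diff0 mulr_sumr.
  by apply: eq_bigr => i _; rewrite displacementE /l rmorphM /=; ring.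
have len_neq0 (i : 'I_K) : rho ^+ i.+1 != 0 by rewrite expf_neq0 ?gt_eqF.
split=> [n /andP[jn nk] | ].
  have /eqP := l_eq0 n; rewrite /l gE ltnNge (ltnW jn) -val_eqE /= (gtn_eqF jn).
  rewrite nk mul1r mulf_eq0 invr_eq0 (negPf (len_neq0 n)) orbF.
  by case: (u n); rewrite // oner_eq0.
have s_eq1 : s = 1.
  have /eqP := l_eq0 j; rewrite /l gE ltnn eqxx uj mul1r mulf_eq0 invr_eq0.
  by rewrite (negPf (len_neq0 j)) orbF subr_eq0 => /eqP.
rewrite zs /junction [RHS]big_mkcond; apply: eq_bigr => i _.
rewrite -/(displacement _ _ _ _ _ _) /progress s_eq1 mul1r ltnS -val_eqE /=.
by case: (ltngtP i j) => _ /=; rewrite ?addr0 ?add0r ?mul1r ?mul0r.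
Qed.
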